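(* Let $p\in\mathbb{N}$, let $X\sim \mathcal{N}_p(\theta,I_p)$ with unknown mean $\theta\in\mathbb{R}^p$, and consider estimation of $\theta$ under the loss $L(\theta,\hat\theta)=\|\hat\theta-\theta\|^2$. Let $\phi:[0,\infty)\to\mathbb{R}$ satisfy both of the following conditions: (i) $\phi$ is weakly differentiable with bounded (weak) derivative $\phi'$; (ii) for some $a>0$, $0<\phi(w)\le w$ for all $w\in(0,a)$ and $\phi(w)=0$ for all $w\in[a,\infty)$. Suppose moreover that, with this $a$, one of the following two cases holds: Case 1: $\limsup_{w\nearrow a}\phi'(w)<0$. Case 2: $\lim_{w\nearrow a}\phi'(w)=0$, and there exist $0<\epsilon<1$ and $\gamma>1$ such that $$-\gamma<(a-w)\frac{\phi'(w)}{\phi(w)}<-\frac{1}{\gamma}\qquad\text{for all } w\in(\epsilon a,a).$$ Then the estimator $$\hat\theta_\phi(X)=\left(1-\frac{\phi(\|X\|^2)}{\|X\|^2}\right)X$$ is not minimax.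
   Context: $\|\cdot\|$ is the Euclidean norm and $I_p$ the $p\times p$ identity matrix. The risk of an estimator $\hat\theta=\hat\theta(X)$ (a measurable function $\mathbb{R}^p\to\mathbb{R}^p$) is $R(\theta,\hat\theta)=\mathrm{E}[\|\hat\theta(X)-\theta\|^2]$, the expectation being over $X\sim\mathcal{N}_p(\theta,I_p)$. An estimator $\hat\theta$ is minimax if $\sup_{\theta\in\mathbb{R}^p}R(\theta,\hat\theta)=\inf_{\delta}\sup_{\theta\in\mathbb{R}^p}R(\theta,\delta)$, where the infimum is over all estimators $\delta$. The value of $\hat\theta_\phi$ at $X=0$ is immaterial (a null event). A function that is weakly differentiable with bounded weak derivative is identified with its (Lipschitz) continuous representative; $\phi'$ is its weak derivative, defined almost everywhere, and pointwise conditions and limits involving $\phi'$ are understood up to null sets. *)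

(* Defs.v *)
From HB Require Import structures.
From mathcomp Require Import all_boot all_order all_algebra.
From mathcomp Require Import all_classical all_reals all_analysis.

Set Implicit Arguments.
Unset Strict Implicit.
Unset Printing Implicit Defensive.

Import Order.TTheory GRing.Theory Num.Theory.
Import numFieldNormedType.Exports.

Local Open Scope classical_set_scope.
Local Open Scope ring_scope.

(** Points of R^p are [p.-tuple R], which carries the Borel (product)
    sigma-algebra generated by the coordinate maps. *)

Section Euclidean.
Context {R : realType} {p : nat}.
Implicit Types x y : p.-tuple R.

Definition tsub x y : p.-tuple R := [tuple tnth x i - tnth y i | i < p].

Definition tscale (c : R) x : p.-tuple R := [tuple c * tnth x i | i < p].

(* The norm that MathComp-Analysis puts on 'rV[R]_p is the sup norm. *)
Definition enorm x : R := Num.sqrt (\sum_(i < p) tnth x i ^+ 2).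

End Euclidean.

Section MultivariateNormal.
Context {R : realType}.

Definition tcons (p : nat) (u : measurableTypeR R * p.-tuple R) :
    p.+1.-tuple R :=
  [tuple of (u.1 : R) :: u.2].

Lemma measurable_tcons p :
  measurable_fun [set: measurableTypeR R * p.-tuple R] (@tcons p).
Proof.
apply: (@measurable_cons _ _ _ R (fun u : measurableTypeR R * p.-tuple R => u.1)).
  by move=> mT Y mY; apply: (measurable_fst mT).
exact: measurable_snd.
Qed.

HB.instance Definition _ p :=
  @isMeasurableFun.Build _ _ _ _ (@tcons p) (@measurable_tcons p).

(** [mvnormal theta] is N_p(theta, I_p), the law of a vector with independent
    N(theta_i, 1) coordinates, built one coordinate at a time;
    [mvnormal_box] shows that it is the product of these normal laws. *)
Fixpoint mvnormal (p : nat) :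
    p.-tuple R -> probability (p.-tuple R) R :=
  match p with
  | 0 => fun theta => \d_ theta
  | q.+1 => fun theta =>
      distribution
        (normal_prob (thead theta) 1 \x
          mvnormal (behead_tuple theta : q.-tuple R))%E
        (@tcons q)
  end.

Lemma measurable_tbox p (A : 'I_p -> set R) :
  (forall i, measurable (A i)) ->
  measurable [set x : p.-tuple R | forall i, A i (tnth x i)].
Proof.
move=> mA; rewrite (_ : mkset _ =
    \bigcap_(i in [set: 'I_p]) ((fun x : p.-tuple R => tnth x i) @^-1` A i)).
  apply: fin_bigcap_measurable; first exact: finite_finset.
  move=> i _; rewrite -[X in measurable X]setTI.
  exact: measurable_tnth.
by apply/seteqP; split=> x /= Ax i => [_|]; exact: Ax.
Qed.

Lemma mvnormal_box p (theta : p.-tuple R) (A : 'I_p -> set R) :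
  (forall i, measurable (A i)) ->
  mvnormal theta [set x | forall i, A i (tnth x i)] =
  (\prod_(i < p) normal_prob (tnth theta i) 1 (A i))%E.
Proof.
elim: p => [|p IHp] in theta A * => mA.
  rewrite big_ord0 /= (_ : mkset _ = setT); first exact: diracT.
  by apply/seteqP; split=> x //= _ [].
rewrite big_ord_recl /= /distribution /pushforward /=.
rewrite (_ : _ @^-1` _ = A ord0 `*`
    [set x : p.-tuple R | forall i, A (lift ord0 i) (tnth x i)]); last first.
  apply/seteqP; split=> -[u x] /=.
    move=> Aux; split=> [|i]; first exact: (Aux ord0).
    by have := Aux (lift ord0 i); rewrite tnthS.
  move=> [Au Ax] i; case: (unliftP ord0 i) => [j ->|->//].
  by rewrite tnthS; exact: Ax.
rewrite product_measure1E; first last.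
- exact: (@measurable_tbox p (fun i => A (lift ord0 i)) (fun i => mA _)).
- exact: mA.
congr (_ * _)%E.
apply: (etrans (IHp (behead_tuple theta) (fun i => A (lift ord0 i)) _)) => //.
by apply: eq_bigr => i _; rewrite tnth_behead; congr (normal_prob (tnth _ _) _ _);
  apply: val_inj; rewrite /= inordK// ltnS.
Qed.

End MultivariateNormal.

Section DecisionTheory.
Context {R : realType} {p : nat}.
Implicit Types (theta : p.-tuple R) (d : p.-tuple R -> p.-tuple R).

Definition risk theta d : \bar R :=
  'E_(mvnormal theta)[fun x => enorm (tsub (d x) theta) ^+ 2].

Definition sup_risk d : \bar R := ereal_sup (range (risk ^~ d)).

(* The infimum ranges over the measurable maps. [d] itself is not required to be
   measurable, so that [~ minimax d] is a statement about its risk only. *)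
Definition minimax d : Prop :=
  sup_risk d =
  ereal_inf (range (fun e : {mfun p.-tuple R >-> p.-tuple R} => sup_risk e)).

(* Since 0^-1 = 0, the origin is sent to itself. *)
Definition shrinkage (phi : R -> R) (x : p.-tuple R) : p.-tuple R :=
  tscale (1 - phi (enorm x ^+ 2) / enorm x ^+ 2) x.

End DecisionTheory.

Section WeakDerivative.
Context {R : realType}.
Local Notation mu := (@lebesgue_measure R).
Implicit Types (D : set R) (f g h : R -> R).

Definition test_function D h : Prop :=
  (forall n x, derivable h^`(n)%classic x 1) /\
  (exists K, [/\ compact K, K `<=` D & forall x, ~ K x -> h x = 0]).

Definition weak_derivative D f g : Prop :=
  [/\ locally_integrable D f, locally_integrable D g &
    forall h, test_function D h ->
      \int[mu]_(x in D) (f x * h^`()%classic x) = - \int[mu]_(x in D) (g x * h x)].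

Definition ae_bounded D g : Prop :=
  exists M : R, {ae mu, forall x, D x -> `|g x| <= M}.

(** Left neighbourhoods of [a] up to null sets: limits and limsups along this
    filter are essential left limits and limsups at [a], and so depend only on
    the almost everywhere class of a function. *)
Definition ae_at_left (a : R) : set_system R :=
  [set A | exists2 V, a^'- V & {ae mu, forall x, V x -> A x}].

Global Instance ae_at_left_filter a : ProperFilter (ae_at_left a).
Proof.
split=> [[V aV [N [mN N0 VN]]]|].
  have [b ba bV] : exists2 b, b < a & `]b, a[ `<=` V.
    have [e /= e0 eV] := aV; exists (a - e); first by rewrite ltrBlDr ltrDl.
    move=> x /=; rewrite in_itv /= => /andP[bx xa]; apply: eV => //=.
    by rewrite gtr0_norm ?subr_gt0// ltrBlDr -ltrBlDl.
  have : (mu `]b, a[ <= mu N)%E.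
    apply: le_measure; rewrite ?inE//.
    by move=> x xba; apply: VN => /= /(_ (bV x xba)).
  by rewrite N0 lebesgue_measure_itv /= lte_fin ba lee_fin leNgt subr_gt0 ba.
split.
- by exists setT; [exact: filterT|exact: aeW].
- move=> A B [V aV VA] [W aW WB]; exists (V `&` W); first exact: filterI.
  by apply: (@filterS2 _ _ (ae_filter_ringOfSetsType mu) _ _ _ _ VA WB) => x Ax Bx [/Ax Ax' /Bx].
- move=> A B AB [V aV VA]; exists V => //.
  by apply: (@filterS _ _ (ae_filter_ringOfSetsType mu) _ _ _ VA) => x Ax /Ax /AB.
Qed.

End WeakDerivative.

(* Main.v *)
(** Put [w = |x|^2] and [s = phi w / w]. Pointwise, the loss of the shrinkage
    estimator exceeds that of the identity by [s (s w - 2 w + 2 <x, theta>)],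
    which vanishes outside the ball [w < a]. For [theta = (t, 0, ..., 0)] the
    density of N(theta, I) with respect to N(0, I) is [exp (t x_0 - t^2 / 2)].
    Up to the common factor [exp (- t^2 / 2)], the negative part of the excess
    contributes O(t), since there [t x_0 < a], while the positive part
    contributes at least a constant times [exp (t alpha)], from a small cube
    inside the ball on which [x_0 >= alpha > 0]. Hence for large [t] the risk is
    larger than the constant risk of the identity estimator. *)

Require Import Defs.
From HB Require Import structures.
From mathcomp Require Import all_boot all_order all_algebra.
From mathcomp Require Import all_classical all_reals all_analysis.
From mathcomp Require Import measurable_realfun ring lra.

Set Implicit Arguments.
Unset Strict Implicit.
Unset Printing Implicit Defensive.

Import Order.TTheory GRing.Theory Num.Theory.
Import numFieldNormedType.Exports.

Local Open Scope classical_set_scope.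
Local Open Scope ring_scope.

(** * One-dimensional normal laws: density, tilting, second moment *)

Section normal_integral.
Context {R : realType}.
Local Notation mu := (@lebesgue_measure R).
Local Open Scope ereal_scope.

(** The Radon-Nikodym derivative and [normal_pdf] integrate to the same value over every measurable
    set, hence agree almost everywhere. *)
Lemma ge0_integral_normal_prob (m s : R) (f : R -> \bar R) :
  measurable_fun [set: R] f -> (forall x, 0 <= f x) ->
  \int[normal_prob m s]_x f x = \int[mu]_x (f x * (normal_pdf m s x)%:E).
Proof.
move=> mf f0; have dom := @normal_prob_dominates R m s.
rewrite -(Radon_Nikodym_SigmaFinite.change_of_variables dom)//.
have iRN := Radon_Nikodym_SigmaFinite.f_integrable dom.
have mpdf : measurable_fun [set: R] (fun x => (normal_pdf m s x)%:E).
  apply/measurable_EFinP; exact: measurable_normal_pdf.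
apply: ae_eq_integral => //.
- by apply: emeasurable_funM => //; exact: (measurable_int mu).
- exact: emeasurable_funM.
- apply: ae_eqe_mul2l => /=; apply: integral_ae_eq => //.
  by move=> A _ mA; rewrite -Radon_Nikodym_SigmaFinite.f_integral.
Qed.

(** Completing the square: [- (x - t)^2 / 2 = - x^2 / 2 + (t x - t^2 / 2)], and the peak of the
    density does not depend on the mean. *)
Lemma normal_prob_tilt (t : R) (f : R -> \bar R) :
  measurable_fun [set: R] f -> (forall x, 0 <= f x) ->
  \int[normal_prob t 1]_x f x =
  \int[normal_prob 0 1]_x (f x * (expR (t * x - t ^+ 2 / 2))%:E).
Proof.
move=> mf f0; have mtilt : measurable_fun [set: R]
    (fun x => (expR (t * x - t ^+ 2 / 2))%:E).
  by apply/measurable_EFinP/measurableT_comp => //; exact: measurable_funB.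
rewrite [LHS]ge0_integral_normal_prob// [RHS]ge0_integral_normal_prob; first last.
- by move=> x; rewrite mule_ge0// lee_fin expR_ge0.
- exact: emeasurable_funM.
apply: eq_integral => x _; rewrite -muleA -EFinM; congr (_ * _%:E).
rewrite !normal_pdfE ?oner_neq0// /normal_fun mulrCA -expRD.
by congr (_ * expR _)%R; field.
Qed.

(** Translation by [m]. This is what makes the risk of the identity constant in the mean. *)
Lemma integral_normal_prob_sqr_center (m : R) :
  \int[normal_prob m 1]_x ((x - m) ^+ 2)%:E =
  \int[normal_prob 0 1]_x (x ^+ 2)%:E.
Proof.
rewrite [LHS]ge0_integral_normal_prob; first last.
- by move=> x; rewrite lee_fin sqr_ge0.
- by apply/measurable_EFinP/measurable_funX/measurable_funB.
rewrite [RHS]ge0_integral_normal_prob; first last.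
- by move=> x; rewrite lee_fin sqr_ge0.
- by apply/measurable_EFinP/measurable_funX.
under [RHS]eq_integral do rewrite -EFinM.
pose F x : R := (x - m)%R.
have F'E : F^`()%classic = cst 1%R :> (R -> R).
  by apply/funext => x; rewrite derive1E deriveB// derive_cst derive_id subr0.
rewrite [RHS](@increasing_ge0_integration_by_substitutionT _ F).
- apply: eq_integral => x _; rewrite -EFinM F'E !fctE/= mulr1.
  by rewrite !normal_pdfE ?oner_neq0// (normal_fun_center m).
- by move=> x y xy; rewrite /F ltrD2r.
- by rewrite F'E => ?; exact: cvg_cst.
- by rewrite F'E; exact: is_cvg_cst.
- by rewrite F'E; exact: is_cvg_cst.
- by move=> x; exact: derivableB.
- exact: cvg_addrr_Ny.
- exact: cvg_addrr.
- move=> x; apply: cvgM; last exact/continuous_normal_pdf/oner_neq0.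
  exact: sqr_continuous.
- by move=> x; rewrite mulr_ge0 ?sqr_ge0 ?normal_pdf_ge0.
Qed.

(* [y <= expR y] at [y = x ^+ 2 / 4] bounds the integrand by a multiple of the
   density of N(0, 2). *)
Lemma integral_normal_prob_sqr_lty :
  \int[@normal_prob R 0 1]_x (x ^+ 2)%:E < +oo.
Proof.
rewrite ge0_integral_normal_prob//; first last.
- by move=> x; rewrite lee_fin sqr_ge0.
- by apply/measurable_EFinP/measurable_funX.
pose s : R := Num.sqrt 2; have s0 : s != 0%R by rewrite gt_eqF// sqrtr_gt0.
(* The 4 comes from [x^2 = 4 y]; the quotient of peaks exchanges the normalising constants of N(0,
   1) and N(0, 2). *)
pose k : R := (4 * normal_peak 1 / normal_peak s)%R.
have k0 : (0 <= k)%R by rewrite !mulr_ge0 ?invr_ge0 ?normal_peak_ge0.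
apply: (@le_lt_trans _ _ (\int[mu]_x (k%:E * (normal_pdf 0 s x)%:E))).
  apply: ge0_le_integral => //.
  - by move=> x _; rewrite mule_ge0 ?lee_fin ?sqr_ge0 ?normal_pdf_ge0.
  - apply: emeasurable_funM; first exact/measurable_EFinP/measurable_funX.
    apply/measurable_EFinP; exact: measurable_normal_pdf.
  - apply: emeasurable_funM => //.
    apply/measurable_EFinP; exact: measurable_normal_pdf.
  move=> x _; rewrite -!EFinM lee_fin !normal_pdfE ?oner_neq0//.
  rewrite /k [leRHS]mulrA divfK ?gt_eqF ?normal_peak_gt0//.
  rewrite mulrCA [leRHS]mulrAC [leRHS]mulrC ler_wpM2l ?normal_peak_ge0//.
  rewrite /normal_fun subr0 sqr_sqrtr// expr1n.
  have -> : (- x ^+ 2 / 2%:R = - x ^+ 2 / (2 *+ 2) + - (x ^+ 2 / 4))%R by field.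
  rewrite expRD mulrCA [leRHS]mulrC ler_wpM2l ?expR_ge0// expRN.
  rewrite ler_pdivrMr ?expR_gt0//.
  have := expR_ge1Dx (x ^+ 2 / 4)%R; lra.
rewrite integralZl//; last exact: integrable_normal_pdf.
by rewrite integral_normal_pdf mule1 ltry.
Qed.

End normal_integral.

(** * Multivariate normal laws by induction on the dimension *)

Section mvnormal_theory.
Context {R : realType}.

(** The density is continuous and positive, so on a compact interval it is bounded below by its
    positive minimum. *)
Lemma normal_prob_itvcc_gt0 (m s a b : R) : s != 0 -> a < b ->
  (0 < normal_prob m s `[a, b]%classic)%E.
Proof.
move=> s0 ab.
have [c _ pdfc] : exists2 c, c \in `[a, b] &
    forall x, x \in `[a, b] -> normal_pdf m s c <= normal_pdf m s x.
  apply: EVT_min; first exact: ltW.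
  by apply: continuous_subspaceT; exact: continuous_normal_pdf.
have pdfc0 : 0 < normal_pdf m s c.
  by rewrite normal_pdfE// mulr_gt0 ?normal_peak_gt0 ?expR_gt0.
apply: (@lt_le_trans _ _ (\int[lebesgue_measure]_(x in `[a, b])
  (normal_pdf m s c)%:E)%E).
  rewrite integral_cst//= lebesgue_measure_itv/= lte_fin ab -EFinD -EFinM.
  by rewrite lte_fin mulr_gt0// subr_gt0.
apply: ge0_le_integral => //.
- by move=> x _; rewrite lee_fin ltW.
- by apply/measurable_EFinP/measurable_funTS; exact: measurable_normal_pdf.
Qed.

Lemma mvnormal_cube_gt0 p (theta : p.-tuple R) (a b : R) : a < b ->
  (0 < mvnormal theta [set x | forall i, `[a, b]%classic (tnth x i)])%E.
Proof.
move=> ab; rewrite (mvnormal_box _ (A := fun=> `[a, b]%classic))//.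
elim/big_ind : _ => [|x y x0 y0|i _]; rewrite ?lte01//; first exact: mule_gt0.
by apply: normal_prob_itvcc_gt0; rewrite ?oner_neq0.
Qed.

(** One step of the recursion defining [mvnormal], by change of variables and Tonelli. *)
Lemma ge0_integral_mvnormalS q (theta : q.+1.-tuple R)
    (f : q.+1.-tuple R -> \bar R) :
  measurable_fun setT f -> (forall x, 0 <= f x)%E ->
  (\int[mvnormal theta]_x f x =
   \int[normal_prob (thead theta) 1]_u
     \int[mvnormal (behead_tuple theta)]_x f (tcons (u, x)))%E.
Proof.
move=> mf f0; rewrite ge0_integral_distribution//.
rewrite fubini_tonelli1//=.
by apply: measurableT_comp => //; exact: measurable_tcons.
Qed.

Lemma measurable_thead q :
  measurable_fun setT (fun x : q.+1.-tuple R => thead x).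
Proof. exact: measurable_tnth. Qed.

(** Only the mean of the first coordinate moves, so the one-dimensional tilt applies to the outer
    integral; its factor is constant in the remaining coordinates and passes inside. *)
Lemma mvnormal_tilt q (t : R) (theta : q.-tuple R)
    (f : q.+1.-tuple R -> \bar R) :
  measurable_fun setT f -> (forall x, 0 <= f x)%E ->
  (\int[mvnormal [tuple of t :: theta]]_x f x =
   \int[mvnormal [tuple of 0%R :: theta]]_x
     (f x * (expR (t * thead x - t ^+ 2 / 2))%:E))%E.
Proof.
move=> mf f0.
have mtilt : measurable_fun setT
    (fun x : q.+1.-tuple R => (expR (t * thead x - t ^+ 2 / 2))%:E).
  apply/measurable_EFinP/measurableT_comp => //; apply: measurable_funB => //.
  by apply: measurable_funM => //; exact: measurable_thead.
rewrite [LHS]ge0_integral_mvnormalS// [RHS]ge0_integral_mvnormalS; first last.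
- by move=> x; rewrite mule_ge0// lee_fin expR_ge0.
- exact: emeasurable_funM.
have beheadE s : behead_tuple [tuple of s :: theta] = theta by exact: val_inj.
have mftcons : measurable_fun setT (f \o @tcons R q).
  by apply: measurableT_comp => //; exact: measurable_tcons.
rewrite !beheadE !theadE normal_prob_tilt; first last.
- by move=> u; exact: integral_ge0.
- by apply: (measurable_fun_fubini_tonelli_F _ mftcons) => u; exact: f0.
apply: eq_integral => u _; rewrite -ge0_integralZr//.
- exact: (measurableT_comp mftcons (measurable_pair1 u)).
Qed.

Lemma measurable_sqr_dist p (theta : p.-tuple R) : measurable_fun setT
  (fun x : p.-tuple R => \sum_(i < p) (tnth x i - tnth theta i) ^+ 2).
Proof.
apply: measurable_sum => i; apply: measurable_funX; apply: measurable_funB => //.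
exact: measurable_tnth.
Qed.

(** Each coordinate contributes the same centred second moment. The right-hand side is free of
    [theta]: the identity has constant risk. *)
Lemma integral_mvnormal_sqr_dist p (theta : p.-tuple R) :
  (\int[mvnormal theta]_x (\sum_(i < p) (tnth x i - tnth theta i) ^+ 2)%:E =
   p%:R%:E * \int[normal_prob 0 1]_u (u ^+ 2)%:E)%E.
Proof.
elim: p theta => [|p IHp] theta.
  by rewrite mul0e; apply: integral0_eq => x _; rewrite big_ord0.
rewrite ge0_integral_mvnormalS; first last.
- by move=> x; rewrite lee_fin sumr_ge0// => i _; exact: sqr_ge0.
- by apply/measurable_EFinP; exact: measurable_sqr_dist.
set c := (\int[normal_prob 0 1]_u _)%E.
have c0 : (0 <= c)%E by apply: integral_ge0 => u _; rewrite lee_fin sqr_ge0.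
have dist_tcons u x :
    (\sum_(i < p.+1) (tnth (tcons (u, x)) i - tnth theta i) ^+ 2)%:E =
    (((u - thead theta) ^+ 2)%:E + (\sum_(i < p)
      (tnth x i - tnth (behead_tuple theta) i) ^+ 2)%:E)%E.
  rewrite big_ord_recl EFinD; congr (_ + _%:E)%E.
  by apply: eq_bigr => i _; rewrite tnthS tnth_behead; congr ((_ - tnth _ _) ^+ 2);
    apply: val_inj; rewrite /= inordK// ltnS.
transitivity (\int[normal_prob (thead theta) 1]_u
    (((u - thead theta) ^+ 2)%:E + p%:R%:E * c))%E.
  apply: eq_integral => u _; under eq_integral do rewrite dist_tcons.
  rewrite ge0_integralD//.
  - by rewrite IHp integral_cst//= probability_setT mule1.
  - by move=> x _; rewrite lee_fin sqr_ge0.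
  - by move=> x _; rewrite lee_fin sumr_ge0// => i _; exact: sqr_ge0.
  - by apply/measurable_EFinP; exact: measurable_sqr_dist.
rewrite ge0_integralD//.
- rewrite integral_cst//= probability_setT mule1 integral_normal_prob_sqr_center.
  by rewrite -natr1 [(_ + 1)%R]addrC EFinD ge0_muleDl ?lee_fin// mul1e.
- by move=> u _; rewrite lee_fin sqr_ge0.
- by apply/measurable_EFinP/measurable_funX/measurable_funB.
- by move=> u _; rewrite mule_ge0 ?lee_fin.
Qed.

Lemma enorm_sqr p (x : p.-tuple R) : enorm x ^+ 2 = \sum_(i < p) tnth x i ^+ 2.
Proof. by rewrite sqr_sqrtr// sumr_ge0// => i _; exact: sqr_ge0. Qed.

End mvnormal_theory.

(** Makes the identity a competitor in the infimum of [minimax]. *)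
HB.instance Definition _ d (T : measurableType d) :=
  @isMeasurableFun.Build _ _ _ _ (@idfun T) (@measurable_id _ _ setT).

(** * Risk comparison with the identity estimator *)

Section risk_of_shrinkage.
Context {R : realType}.

Lemma riskE p (theta : p.-tuple R) d : risk theta d =
  (\int[mvnormal theta]_x
     (\sum_(i < p) (tnth (d x) i - tnth theta i) ^+ 2)%:E)%E.
Proof.
rewrite /risk unlock; apply: eq_integral => x _.
by rewrite enorm_sqr; under eq_bigr do rewrite tnth_mktuple.
Qed.

(** The supremum risk of [d] is at most that of the identity, whose risk is the same at every
    mean. *)
Lemma minimax_risk_le p (d : p.-tuple R -> p.-tuple R) theta :
  minimax d -> (risk theta d <= risk theta id)%E.
Proof.
move=> mmd; apply: (@le_trans _ _ (sup_risk d)).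
  by apply: ereal_sup_ubound; exists theta.
rewrite mmd; apply: (@le_trans _ _ (sup_risk (@id (p.-tuple R)))).
  by apply: ereal_inf_lbound; exists idfun.
apply: ge_ereal_sup => _ [eta _ <-].
by rewrite !riskE !integral_mvnormal_sqr_dist.
Qed.

Lemma risk_id_lty p (theta : p.-tuple R) : (risk theta id < +oo)%E.
Proof.
rewrite riskE integral_mvnormal_sqr_dist.
by rewrite lte_mul_pinfty// integral_normal_prob_sqr_lty.
Qed.

Lemma measurable_enorm_sqr p :
  measurable_fun setT (fun x : p.-tuple R => enorm x ^+ 2).
Proof.
under eq_fun do rewrite enorm_sqr.
by apply: measurable_sum => i; apply: measurable_funX; exact: measurable_tnth.
Qed.

Definition excess_loss p (phi : R -> R) (theta x : p.-tuple R) : R :=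
  let w := enorm x ^+ 2 in
  phi w / w * (phi w / w * w - 2 * w + 2 * \sum_(i < p) tnth x i * tnth theta i).

(** With the quotient [s] kept abstract this is a polynomial identity in each coordinate, so the
    origin needs no separate case. *)
Lemma shrinkage_loss p (phi : R -> R) (theta x : p.-tuple R) :
  \sum_(i < p) (tnth (shrinkage phi x) i - tnth theta i) ^+ 2 =
  \sum_(i < p) (tnth x i - tnth theta i) ^+ 2 + excess_loss phi theta x.
Proof.
rewrite /excess_loss /shrinkage; set s := phi _ / _.
transitivity (\sum_(i < p) ((tnth x i - tnth theta i) ^+ 2 + s *
    (s * tnth x i ^+ 2 - 2 * tnth x i ^+ 2 + 2 * (tnth x i * tnth theta i)))).
  by apply: eq_bigr => i _; rewrite !tnth_mktuple; ring.
by rewrite enorm_sqr big_split/= -mulr_sumr !big_split/= sumrN -!mulr_sumr.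
Qed.

Section excess_loss.
Variables (p : nat) (phi : R -> R) (theta : p.-tuple R).
Hypothesis cphi : {within `[0, +oo[, continuous phi}.

Lemma measurable_excess_loss : measurable_fun setT (excess_loss phi theta).
Proof.
have mw := @measurable_enorm_sqr p.
have mphi : measurable_fun (`[0, +oo[%classic : set R) phi.
  exact: subspace_continuous_measurable_fun.
have ms : measurable_fun setT
    (fun x : p.-tuple R => phi (enorm x ^+ 2) / enorm x ^+ 2).
  apply: measurable_funM.
    apply: (measurable_comp _ _ mphi mw) => //.
    by move=> _ [x _ <-]; rewrite /= in_itv/= sqr_ge0.
  (* On nonnegative reals inversion is the power -1, also at 0, where both give 0. *)
  under eq_fun do rewrite -(powR_inv1 (sqr_ge0 _)).
  exact: (measurableT_comp (measurable_powR (-1)) mw).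
apply: measurable_funM => //; apply: measurable_funD.
  by apply: measurable_funB; exact: measurable_funM.
apply: measurable_funM => //; apply: measurable_sum => i.
by apply: measurable_funM => //; exact: measurable_tnth.
Qed.

(** Splitting the excess into positive and negative parts keeps all integrands nonnegative, so no
    integrability of the excess is required. *)
Lemma minimax_excess_loss : minimax (shrinkage phi : p.-tuple R -> p.-tuple R) ->
  (\int[mvnormal theta]_x (Num.max (excess_loss phi theta x) 0)%:E <=
   \int[mvnormal theta]_x (Num.max (- excess_loss phi theta x) 0)%:E)%E.
Proof.
move=> /minimax_risk_le-/(_ theta); have := risk_id_lty theta.
rewrite !riskE; set P := mvnormal theta.
pose D (x : p.-tuple R) := \sum_(i < p) (tnth x i - tnth theta i) ^+ 2.
have D0 x : 0 <= D x by apply: sumr_ge0 => i _; exact: sqr_ge0.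
have mD : measurable_fun setT D by exact: measurable_sqr_dist.
have mg := measurable_excess_loss.
move: mg (shrinkage_loss phi theta); set g := excess_loss phi theta => mg gE.
have Dg0 x : 0 <= D x + g x.
  by rewrite -gE; apply: sumr_ge0 => i _; exact: sqr_ge0.
under [X in (X <= _ -> _)%E]eq_integral do rewrite gE -/(D _).
move=> iD iDg.
have mgp : measurable_fun setT (fun x => Num.max (g x) 0).
  exact: measurable_maxr.
have mgn : measurable_fun setT (fun x => Num.max (- g x) 0).
  by apply: measurable_maxr => //; exact: measurableT_comp.
have : (\int[P]_x (D x + g x)%:E + \int[P]_x (Num.max (- g x) 0)%:E =
        \int[P]_x (D x)%:E + \int[P]_x (Num.max (g x) 0)%:E)%E.
  rewrite -!ge0_integralD//.
  - apply: eq_integral => x _; rewrite -!EFinD; congr _%:E.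
    by case: (leP (g x) 0) => ?; case: (leP (- g x) 0) => ?; lra.
  - by move=> x _; rewrite lee_fin.
  - exact/measurable_EFinP.
  - by move=> x _; rewrite lee_fin le_max lexx orbT.
  - exact/measurable_EFinP.
  - by move=> x _; rewrite lee_fin.
  - by apply/measurable_EFinP; exact: measurable_funD.
  - by move=> x _; rewrite lee_fin le_max lexx orbT.
  - exact/measurable_EFinP.
(* The finite risk of the identity can be cancelled from both sides. *)
move=> E; have Dfin : (\int[P]_x (D x)%:E)%E \is a fin_num.
  by rewrite ge0_fin_numE// integral_ge0// => x _; rewrite lee_fin.
by rewrite -(@leeD2lE _ (\int[P]_x (D x)%:E)%E)// -E leeD2r.
Qed.

End excess_loss.
End risk_of_shrinkage.

(* The excess loss when the mean lies on the first axis *)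
(* Otherwise unification may unfold the fixpoint [mvnormal] and diverge. *)
#[local] Opaque mvnormal.

(** After tilting, the integrating law no longer involves [t], which remains only in the excess and
    the likelihood ratio. *)
Lemma minimax_excess_loss_tilt (R : realType) (q : nat) (phi : R -> R) (t : R)
    (theta : q.-tuple R) (g := excess_loss phi [tuple of t :: theta]) :
  {within `[0, +oo[, continuous phi} ->
  minimax (shrinkage phi : q.+1.-tuple R -> q.+1.-tuple R) ->
  (\int[mvnormal [tuple of 0%R :: theta]]_x
     ((Num.max (g x) 0)%:E * (expR (t * thead x - t ^+ 2 / 2))%:E) <=
   \int[mvnormal [tuple of 0%R :: theta]]_x
     ((Num.max (- g x) 0)%:E * (expR (t * thead x - t ^+ 2 / 2))%:E))%E.
Proof.
move=> cphi mm; have mg : measurable_fun setT g by exact: measurable_excess_loss.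
have max_ge0 (h : q.+1.-tuple R -> R) x : (0 <= (Num.max (h x) 0)%:E)%E.
  by rewrite lee_fin le_max lexx orbT.
have mgp : measurable_fun setT (fun x => (Num.max (g x) 0)%:E).
  by apply/measurable_EFinP; exact: measurable_maxr.
have mgn : measurable_fun setT (fun x => (Num.max (- g x) 0)%:E).
  by apply/measurable_EFinP/measurable_maxr => //; exact: measurableT_comp.
have Ep := mvnormal_tilt t theta mgp (max_ge0 g).
have En := mvnormal_tilt t theta mgn (max_ge0 (fun x => - g x)).
by rewrite -Ep -[leRHS]En; exact: minimax_excess_loss.
Qed.

Lemma excess_loss_cons (R : realType) (q : nat) (phi : R -> R) (t : R)
    (x : q.+1.-tuple R) :
  excess_loss phi [tuple of t :: nseq q 0] x =
  phi (enorm x ^+ 2) / enorm x ^+ 2 *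
    (phi (enorm x ^+ 2) / enorm x ^+ 2 * enorm x ^+ 2 - 2 * enorm x ^+ 2
     + 2 * (t * thead x)).
Proof.
rewrite /excess_loss big_ord_recl big1 ?addr0 => [|i _].
  by rewrite [tnth x ord0 * _]mulrC.
by rewrite [X in _ * X](tnth_nth 0)/= nth_nseq if_same mulr0.
Qed.

(* A negative excess loss forces [t * thead x <= a], which bounds the likelihood
   ratio. *)
Lemma excess_loss_neg_le (R : realType) (q : nat) (phi : R -> R) (a t : R)
    (x : q.+1.-tuple R) : 0 < a -> 1 <= t ->
  (forall w, 0 < w < a -> 0 < phi w <= w) ->
  (forall w, a <= w -> phi w = 0) ->
  Num.max (- excess_loss phi [tuple of t :: nseq q 0] x) 0 * expR (t * thead x)
    <= (4 * a + 2) * t * expR a.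
Proof.
move=> a0 t1 phi_in phi_out; rewrite excess_loss_cons.
have x0w : thead x ^+ 2 <= enorm x ^+ 2.
  rewrite enorm_sqr big_ord_recl lerDl sumr_ge0// => i _; exact: sqr_ge0.
move: x0w; set w := enorm x ^+ 2; set y := thead x => x0w.
have rhs0 : 0 <= (4 * a + 2) * t * expR a.
  by rewrite !mulr_ge0 ?expR_ge0//; lra.
have [wa|aw] := ltP w a; last first.
  by rewrite phi_out// !mul0r oppr0 maxxx mul0r.
have w0 : 0 <= w by exact: sqr_ge0.
have [->|wN0] := eqVneq w 0.
  by rewrite invr0 mulr0 !mul0r oppr0 maxxx mul0r.
have /andP[phi0 phiw] : 0 < phi w <= w by apply: phi_in; rewrite lt0r wN0 w0.
set s := phi w / w.
have s0 : 0 <= s by rewrite divr_ge0// ltW.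
have s1 : s <= 1 by rewrite ler_pdivrMr ?mul1r// lt0r wN0 w0.
have [g0|g0] := leP 0 (s * w - 2 * w + 2 * (t * y)).
  by rewrite max_r ?mul0r// oppr_le0 mulr_ge0.
rewrite max_l; last by rewrite oppr_ge0 mulr_ge0_le0// ltW.
(* Negativity of the bracket gives [2 t y < 2 w - s w <= 2 w < 2 a]. *)
have tya : t * y <= a by nra.
apply: ler_pM; rewrite ?expR_ge0 ?ler_expR//.
  by rewrite oppr_ge0 mulr_ge0_le0// ltW.
(* Since [y^2 <= w < a <= (1 + a)^2]; this avoids a square root. *)
have y1 : - (1 + a) <= y by nra.
have ty : - (t * (1 + a)) <= t * y by nra.
have sw : 0 <= s * w by rewrite mulr_ge0.
(* As [s <= 1], drop it; the rest is at most [2 a + 2 t (1 + a)], hence at most [(4 a + 2) t]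
   because [t >= 1]. *)
rewrite -mulrN; apply: (@le_trans _ _ (- (s * w - 2 * w + 2 * (t * y)))).
  by rewrite ler_piMl// oppr_ge0 ltW.
nra.
Qed.

(** The last hypothesis forces the bracket in the excess to be at least 1, since [2 w < 2 a]; the
    excess is then at least [phi w / w], itself at least [m / a]. *)
Lemma excess_loss_pos_ge (R : realType) (q : nat) (phi : R -> R)
    (a t alpha m : R) (x : q.+1.-tuple R) :
  0 < alpha -> alpha <= thead x -> 0 < enorm x ^+ 2 < a ->
  0 < m <= phi (enorm x ^+ 2) -> 1 + 2 * a <= 2 * (t * alpha) ->
  m / a * expR (t * alpha) <=
  Num.max (excess_loss phi [tuple of t :: nseq q 0] x) 0 * expR (t * thead x).
Proof.
rewrite excess_loss_cons; set w := enorm x ^+ 2; set y := thead x.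
move=> alpha0 alphay /andP[w0 wa] /andP[m0 mphi] ta.
have a0 : 0 < a by exact: lt_trans wa.
have t0 : 0 < t by rewrite -(pmulr_lgt0 _ alpha0); lra.
have ty : t * alpha <= t * y by rewrite ler_wpM2l// ltW.
apply: ler_pM; rewrite ?expR_ge0 ?ler_expR//; first by rewrite divr_ge0 ?ltW.
set s := phi w / w; have ms : m / a <= s.
  by apply: ler_pM => //; rewrite ?invr_ge0 ?ltW// ltf_pV2.
have s0 : 0 < s by rewrite (lt_le_trans _ ms)// divr_gt0.
have sw : 0 < s * w by rewrite mulr_gt0.
rewrite le_max (le_trans ms)// ler_peMr ?ltW//.
lra.
Qed.

(** * Contradiction for a large first coordinate of the mean *)

Theorem theorem4p1 (R : realType) (p : nat) (phi phi' : R -> R) (a : R) :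
  (0 < p)%N ->
  {within `[0, +oo[, continuous phi} ->
  weak_derivative `]0, +oo[ phi phi' ->
  ae_bounded `]0, +oo[ phi' ->
  0 < a ->
  (forall w, 0 < w < a -> 0 < phi w <= w) ->
  (forall w, a <= w -> phi w = 0) ->
  (limf_esup (EFin \o phi') (ae_at_left a) < 0)%E \/
  (phi' w @[w --> ae_at_left a] --> 0 /\
   exists eps gamma : R, [/\ 0 < eps < 1, 1 < gamma &
     {ae lebesgue_measure, forall w, eps * a < w < a ->
       - gamma < (a - w) * (phi' w / phi w) < - gamma^-1}]) ->
  ~ minimax (shrinkage phi : p.-tuple R -> p.-tuple R).
Proof.
case: p => [//|q] _ cphi _ _ a0 phi_in phi_out _ mm.
pose P t := mvnormal [tuple of t :: nseq q (0 : R)].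
(* Chosen so that the cube with sides [[alpha, beta]] lies in the shell where [|x|^2] is between
   [a / 4] and [a / 2], away from both 0 and [a]. *)
pose alpha := Num.sqrt (a / (4 * q.+1%:R)).
pose beta := Num.sqrt (a / (2 * q.+1%:R)).
have q0 : 0 < q.+1%:R :> R by rewrite ltr0n.
have alpha0 : 0 < alpha by rewrite sqrtr_gt0 divr_gt0// mulr_gt0.
have alpha2 : alpha ^+ 2 * q.+1%:R = a / 4.
  by rewrite sqr_sqrtr ?divr_ge0 ?mulr_ge0 ?ltW//; field; lra.
have beta2 : beta ^+ 2 * q.+1%:R = a / 2.
  by rewrite sqr_sqrtr ?divr_ge0 ?mulr_ge0 ?ltW//; field; lra.
have alphabeta : alpha < beta.
  rewrite ltr_sqrt ?divr_gt0 ?mulr_gt0//.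
  by rewrite ltr_pM2l// ltf_pV2 ?posrE ?mulr_gt0// ltr_pM2r//; lra.
pose cube := [set x : q.+1.-tuple R | forall i, `[alpha, beta]%classic (tnth x i)].
have mcube : measurable cube by exact: (@measurable_tbox _ _ (fun=> `[alpha, beta]%classic)).
have enorm_cube x : cube x -> enorm x ^+ 2 \in `[a / 4, a / 2].
  move=> xcube; rewrite enorm_sqr in_itv/= -alpha2 -beta2.
  have sum_const r : r * q.+1%:R = \sum_(i < q.+1) r :> R.
    by rewrite sumr_const card_ord mulr_natr.
  have xI i : alpha <= tnth x i <= beta by have := xcube i; rewrite /= in_itv.
  have x0 i : 0 <= tnth x i.
    by have /andP[+ _] := xI i; exact/le_trans/ltW.
  rewrite !sum_const; apply/andP; split; apply: ler_sum => i _;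
    have /andP[xi1 xi2] := xI i.
    by apply: lerXn2r; rewrite ?nnegrE ?x0 ?(ltW alpha0).
  by apply: lerXn2r; rewrite ?nnegrE ?x0 ?(le_trans (x0 i)).
(* The minimum of [phi] over the shell is attained, hence positive. *)
have [c cI phic] : exists2 c, c \in `[a / 4, a / 2] &
    forall w, w \in `[a / 4, a / 2] -> phi c <= phi w.
  apply: EVT_min; first by lra.
  apply: continuous_subspaceW cphi => w /=; rewrite !in_itv/= andbT; lra.
have {cI} phic0 : 0 < phi c.
  move: cI; rewrite in_itv/= => cI.
  by have /andP[] := phi_in c ltac:(lra).
have [m m0 mE] : exists2 m : R, 0 < m & P 0 cube = m%:E.
  exists (fine (P 0 cube)); last by rewrite fineK// fin_num_measure.
  rewrite fine_gt0//; apply/andP; split; first exact: mvnormal_cube_gt0.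
  exact: le_lt_trans (probability_le1 _ mcube) (ltry _).
(* Exponential against linear growth in [t]: [phi c], [alpha] and the cube mass [m] do not depend on
   [t], and the common factor [k] cancels. *)
have key t : 1 <= t -> 1 + 2 * a <= 2 * (t * alpha) ->
    phi c / a * expR (t * alpha) * m <= (4 * a + 2) * t * expR a.
  move=> t1 ta; pose g := excess_loss phi [tuple of t :: nseq q (0 : R)].
  have mg : measurable_fun setT g by exact: measurable_excess_loss.
  have mgp : measurable_fun setT (fun x => (Num.max (g x) 0)%:E).
    by apply/measurable_EFinP; exact: measurable_maxr.
  have mgn : measurable_fun setT (fun x => (Num.max (- g x) 0)%:E).
    by apply/measurable_EFinP/measurable_maxr => //; exact: measurableT_comp.
  pose F (h : q.+1.-tuple R -> R) : \bar R := (\int[P 0%R]_x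
    ((Num.max (h x) 0)%:E * (expR (t * thead x - t ^+ 2 / 2))%:E))%E.
  have max_ge0 (h : q.+1.-tuple R -> R) x : (0 <= (Num.max (h x) 0)%:E)%E.
    by rewrite lee_fin le_max lexx orbT.
  have FpFn : (F g <= F (fun x => - g x)%R)%E.
    exact: minimax_excess_loss_tilt.
  pose k : R := expR (- (t ^+ 2 / 2)); have k0 : 0 < k by exact: expR_gt0.
  have mtilt : measurable_fun setT
      (fun x : q.+1.-tuple R => (expR (t * thead x - t ^+ 2 / 2))%:E).
    apply/measurable_EFinP/measurableT_comp => //; apply: measurable_funB => //.
    by apply: measurable_funM => //; exact: measurable_thead.
  have lower : ((phi c / a * expR (t * alpha) * k * m)%:E <= F g)%E.
    rewrite EFinM -mE -integral_cst//.
    apply: (@le_trans _ _ (\int[P 0%R]_(x in cube) ((Num.max (g x) 0)%:E *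
        (expR (t * thead x - t ^+ 2 / 2))%:E)))%E; last first.
      apply: ge0_subset_integral => //; first exact: emeasurable_funM.
      by move=> x _; rewrite mule_ge0// lee_fin expR_ge0.
    apply: ge0_le_integral => //.
    - by move=> x _; rewrite lee_fin !mulr_ge0 ?invr_ge0 ?expR_ge0// ltW.
    - by apply: measurable_funTS; exact: emeasurable_funM.
    move=> x xcube; rewrite -EFinM lee_fin expRD mulrA ler_wpM2r ?(ltW k0)//.
    have xI := enorm_cube _ xcube; have := xI; rewrite in_itv/= => xI'.
    apply: excess_loss_pos_ge => //.
    - by have /= := xcube ord0; rewrite in_itv/= => /andP[].
    - by lra.
    - by rewrite phic0 phic.
  have upper : (F (fun x => - g x)%R <= ((4 * a + 2) * t * expR a * k)%:E)%E.
    apply: (@le_trans _ _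
        (\int[P 0%R]_x (((4 * a + 2) * t * expR a * k)%:E)))%E; last first.
      by rewrite integral_cst//= probability_setT mule1.
    apply: ge0_le_integral => //.
    - by move=> x _; rewrite mule_ge0 ?lee_fin ?expR_ge0 ?le_max ?lexx ?orbT.
    - exact: emeasurable_funM.
    move=> x _; rewrite -EFinM lee_fin expRD mulrA ler_wpM2r ?(ltW k0)//.
    exact: excess_loss_neg_le.
  have := le_trans lower (le_trans FpFn upper); rewrite lee_fin.
  by rewrite [leLHS]mulrAC ler_pM2r.
pose eta := phi c / a * m.
have eta0 : 0 < eta by rewrite mulr_gt0// divr_gt0.
(* [A] is the threshold for the second premise of [key]; beyond [B], the quadratic term
   [eta (t alpha)^2 / 2] exceeds the linear bound. *)
pose A := (1 + 2 * a) / (2 * alpha).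
pose B := 2 * ((4 * a + 2) * expR a) / (eta * alpha ^+ 2).
have A0 : 0 <= A by rewrite divr_ge0//; lra.
have e0 : 0 <= 2 * ((4 * a + 2) * expR a).
  by rewrite !mulr_ge0 ?expR_ge0//; lra.
have B0 : 0 <= B by rewrite divr_ge0// mulr_ge0 ?exprn_ge0 ?ltW.
have [t [t1 At Bt]] : exists t, [/\ 1 <= t, A <= t & B < t].
  by exists (1 + A + B); split; lra.
have ta : 1 + 2 * a <= 2 * (t * alpha).
  by move: At; rewrite /A ler_pdivrMr ?mulr_gt0// mulrCA.
have tB : 2 * ((4 * a + 2) * expR a) < t * (eta * alpha ^+ 2).
  by rewrite -ltr_pdivrMr// mulr_gt0 ?exprn_gt0.
have := key t t1 ta; apply/negP; rewrite -ltNge.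
have talpha0 : 0 <= t * alpha by rewrite mulr_ge0 ?(ltW alpha0)//; lra.
(* The index 1 selects the degree 2 term of the exponential series, enough to beat a linear
   bound. *)
have expt : 1 + (t * alpha) ^+ 2 / 2 <= expR (t * alpha) :=
  expR_ge1Dxn 1 talpha0.
rewrite [ltRHS]mulrAC -/eta.
apply: (@lt_le_trans _ _ (eta * ((t * alpha) ^+ 2 / 2))); last first.
  rewrite ler_wpM2l ?(ltW eta0)//; apply: le_trans expt; lra.
have t_gt0 : 0 < t by lra.
have -> : (4 * a + 2) * t * expR a = t * ((4 * a + 2) * expR a) by ring.
have -> : eta * ((t * alpha) ^+ 2 / 2) = t * (t * (eta * alpha ^+ 2) / 2) by field.
rewrite ltr_pM2l//; lra.
Qed.
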